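(* Each of the following families of sequences can be generated by a loopless algorithm, i.e. an algorithm that, after initialization, produces each successive entry of the sequence in worst-case $O(1)$ time, with the constant independent of $n$ and $m$: (1) for $n \ge 3$, $\mathrm{reuse}_n(\mathcal{R}_{n-1})$; (2) for $n \ge 4$ and $m \in \{2,\ldots,n\}$, $\mathrm{rewind}_m(S)$ where $S$ is $\mathcal{R}_{n-1}$ with its first two entries moved to the end; (3) for $n \ge 4$ and $m \in \{2,\ldots,n\}$, $\mathrm{rewind}_m(S)$ where $S$ is $\mathrm{reuse}_{n-1}(\mathcal{R}_{n-2})$ with its first two entries moved to the end.
   Context: Reuse operation: $\mathrm{reuse}_k(S)$ replaces each entry $r$ of a sequence $S$ by $k$ repeated $k-1$ times followed by $k+1-r$. Recycle operation: $\mathrm{recycle}_k(S)$ replaces each entry $r$ of $S$ by $k, k$, then $k{-}1$ repeated $r-1$ times, then $k$ repeated $k-r-1$ times. Canonical recycle sequences: $\mathcal{R}_1 = 1$, $\mathcal{R}_k = \mathrm{recycle}_k(\mathcal{R}_{k-1})$ for $k > 1$. Rewind operation (with parameter $n$): if $S = T, n{-}1, n{-}1$ has maximum $n-1$ in its last two positions, $\mathrm{rewind}_m(S)$ is the concatenation of $T, n{-}1, n$; then $m-2$ copies of $T, n$; then $T, n{-}1, n$; then $m-2$ copies of $n$. (These sequences are Hamilton sequences for restricted/incomplete rotator graphs with rotation sets $\{2,3,n\}$, $\{n-2,n-1,n\}$ and $\{2,3,n-1,n\}$ respectively.) *)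

(* Defs.v *)
From mathcomp Require Import all_boot.

Set Implicit Arguments.
Unset Strict Implicit.
Unset Printing Implicit Defensive.

Definition reuse (k : nat) (S : seq nat) : seq nat :=
  flatten [seq rcons (nseq k.-1 k) (k.+1 - r) | r <- S].

Definition recycle (k : nat) (S : seq nat) : seq nat :=
  flatten [seq [:: k; k] ++ nseq r.-1 k.-1 ++ nseq (k - r - 1) k | r <- S].

(* The sequences R_k exist for k >= 1 only; [recycle_seq 0] is a dummy. *)
Fixpoint recycle_seq (k : nat) : seq nat :=
  match k with
  | 0 => [::]
  | 1 => [:: 1]
  | k'.+1 => recycle k (recycle_seq k')
  end.

(* Meaningful for S = T ++ [:: n.-1; n.-1]; T is recovered by dropping the
   last two entries. *)
Definition rewind (n m : nat) (S : seq nat) : seq nat :=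
  let T := take (size S - 2) S in
  (T ++ [:: n.-1; n]) ++ flatten (nseq (m - 2) (T ++ [:: n])) ++
  (T ++ [:: n.-1; n]) ++ nseq (m - 2) n.

(* Algorithms are structured programs for a unit-cost random access machine
   with indirect addressing.  Program variables are cells at constant
   addresses. *)
Definition memory := nat -> nat.

Inductive expr : Type :=
  | Const of nat
  | Get of expr
  | Add of expr & expr
  | Sub of expr & expr
  | Eq of expr & expr
  | Leq of expr & expr.

Inductive cmd : Type :=
  | Skip
  | Store of expr & expr
  | Emit of expr
  | Seq of cmd & cmd
  | If of expr & cmd & cmd
  | While of expr & cmd.

Fixpoint eval (s : memory) (e : expr) : nat :=
  match e with
  | Const k => k
  | Get a => s (eval s a)
  | Add e1 e2 => eval s e1 + eval s e2
  | Sub e1 e2 => eval s e1 - eval s e2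
  | Eq e1 e2 => eval s e1 == eval s e2
  | Leq e1 e2 => eval s e1 <= eval s e2
  end.

(* No value computed by e, addresses included, overflows a machine word that
   holds the integers below W. *)
Fixpoint fits (W : nat) (s : memory) (e : expr) : bool :=
  (eval s e < W) &&
  match e with
  | Const _ => true
  | Get a => fits W s a
  | Add e1 e2 | Sub e1 e2 | Eq e1 e2 | Leq e1 e2 => fits W s e1 && fits W s e2
  end.

Fixpoint cost (e : expr) : nat :=
  match e with
  | Const _ => 1
  | Get a => (cost a).+1
  | Add e1 e2 | Sub e1 e2 | Eq e1 e2 | Leq e1 e2 => (cost e1 + cost e2).+1
  end.

Definition update (s : memory) (a v : nat) : memory :=
  fun i => if i == a then v else s i.

(* [exec W c s t out s']: with word bound W, the command c started in memory s
   terminates in memory s' after exactly t elementary operations, having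
   emitted the sequence out.  A run that overflows has no derivation. *)
Inductive exec (W : nat) : cmd -> memory -> nat -> seq nat -> memory -> Prop :=
  | exec_skip s : exec W Skip s 1 [::] s
  | exec_store s a e :
      fits W s a -> fits W s e ->
      exec W (Store a e) s (cost a + cost e).+1 [::]
           (update s (eval s a) (eval s e))
  | exec_emit s e :
      fits W s e -> exec W (Emit e) s (cost e).+1 [:: eval s e] s
  | exec_seq c1 c2 s1 s2 s3 t1 t2 o1 o2 :
      exec W c1 s1 t1 o1 s2 -> exec W c2 s2 t2 o2 s3 ->
      exec W (Seq c1 c2) s1 (t1 + t2) (o1 ++ o2) s3
  | exec_if_true e c1 c2 s s' t o :
      fits W s e -> eval s e != 0 -> exec W c1 s t o s' ->
      exec W (If e c1 c2) s (cost e + t).+1 o s'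
  | exec_if_false e c1 c2 s s' t o :
      fits W s e -> eval s e = 0 -> exec W c2 s t o s' ->
      exec W (If e c1 c2) s (cost e + t).+1 o s'
  | exec_while_true e c s1 s2 s3 t1 t2 o1 o2 :
      fits W s1 e -> eval s1 e != 0 ->
      exec W c s1 t1 o1 s2 -> exec W (While e c) s2 t2 o2 s3 ->
      exec W (While e c) s1 (cost e + t1 + t2).+1 (o1 ++ o2) s3
  | exec_while_false e c s :
      fits W s e -> eval s e = 0 ->
      exec W (While e c) s (cost e).+1 [::] s.

Record algorithm : Type := Algorithm { init : cmd; next : cmd }.

(* [produces W b c s S]: repeatedly calling c from memory s yields the entries
   of S, exactly one per call, followed by a call emitting nothing, which
   signals the end of the sequence; each call takes at most b operations. *)
Inductive produces (W b : nat) (c : cmd) : memory -> seq nat -> Prop :=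
  | produces_end s t s' :
      exec W c s t [::] s' -> t <= b -> produces W b c s [::]
  | produces_entry s t r s' S :
      exec W c s t [:: r] s' -> t <= b -> produces W b c s' S ->
      produces W b c s (r :: S).

(* The memory initially holds the parameters, then zeros.  Initialization takes
   O(n) time, each entry O(1) time, and words have O(log n) bits.  Without the
   bounds on initialization and word size, the whole sequence could be
   precomputed and stored, and looplessness would say nothing. *)
Definition generates_loopless (A : algorithm) (b n : nat) (params S : seq nat) :
    Prop :=
  let W := (n + 2) ^ b in
  exists t s,
    [/\ exec W (init A) (nth 0 params) t [::] s,
        t <= b * n &
        produces W b (next A) s S].

(* Main.v *)
From mathcomp Require Import all_boot zify.
Require Import Defs.

Set Implicit Arguments.
Unset Strict Implicit.
Unset Printing Implicit Defensive.

(* Write a position p < k! in mixed radix k, k-1, ..., 1, least significant digit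
   first.  Entry p of R_k depends only on the first non-maximal digit and on the
   parity of the number of maximal digits before it.  Focus pointers in the style
   of Knuth's loopless reflected Gray code find this digit in O(1) time: a digit
   that becomes maximal is reset to 0 at once, and a pointer records that its
   level is to be skipped next time, so no carry ever propagates.  The same
   counter drives reuse_k(R_{k-1}), whose entries differ from those of R_k only in
   the values emitted.  After k! steps the counter is back in its initial state,
   so the rewind sequence is obtained by running it m times, each time from
   entry 2.  Pointers are stored as offsets, hence the zeroed memory is already
   the initial state of the counter. *)

(* Weakest precondition; loops are excluded, so that [max_time] below bounds the
   running time. *)
Fixpoint wp (c : cmd) (s : memory) (Q : seq nat -> memory -> Prop) : Prop :=
  match c with
  | Skip => Q [::] s
  | Store a e => Q [::] (update s (eval s a) (eval s e))
  | Emit e => Q [:: eval s e] s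
  | Seq c1 c2 => wp c1 s (fun o1 s1 => wp c2 s1 (fun o2 => Q (o1 ++ o2)))
  | If e c1 c2 => if eval s e != 0 then wp c1 s Q else wp c2 s Q
  | While _ _ => False
  end.

Lemma wp_mono c s (Q Q' : seq nat -> memory -> Prop) :
  wp c s Q -> (forall o s', Q o s' -> Q' o s') -> wp c s Q'.
Proof.
elim: c s Q Q' => [|a e|e|c1 IH1 c2 IH2|e c1 IH1 c2 IH2|//] s Q Q' /=.
- by move=> h; apply.
- by move=> h; apply.
- by move=> h; apply.
- move=> h QQ'; apply: IH1 h _ => o s' h; apply: IH2 h _ => o' s'' h.
  exact: QQ'.
- by case: ifP => _; [apply: IH1 | apply: IH2].
Qed.

(** * Bounds on values and running time *)

(** Coefficient of a linear bound on values, see [eval_le]. [Sub] and the tests are charged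
    additively, so that the magnitude of [e] also dominates those of its subexpressions, as [fits]
    requires. *)
Fixpoint magnitude (e : expr) : nat :=
  match e with
  | Const k => k.+1
  | Get a => (magnitude a).+1
  | Add e1 e2 | Sub e1 e2 | Eq e1 e2 | Leq e1 e2 => magnitude e1 + magnitude e2
  end.

Fixpoint growth (c : cmd) : nat :=
  match c with
  | Skip | While _ _ => 1
  | Store a e => magnitude a + magnitude e
  | Emit e => magnitude e
  | Seq c1 c2 => growth c1 * growth c2
  | If e c1 c2 => magnitude e + (growth c1 + growth c2)
  end.

Fixpoint max_time (c : cmd) : nat :=
  match c with
  | Skip | While _ _ => 1
  | Store a e => (cost a + cost e).+1
  | Emit e => (cost e).+1
  | Seq c1 c2 => max_time c1 + max_time c2
  | If e c1 c2 => (cost e + (max_time c1 + max_time c2)).+1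
  end.

Definition bounded (M : nat) (s : memory) := forall a, s a <= M.

Lemma magnitude_gt0 e : 0 < magnitude e.
Proof. by elim: e => //= e1 IH1 e2 IH2; rewrite addn_gt0 IH1. Qed.

Lemma growth_gt0 c : 0 < growth c.
Proof.
elim: c => //= [a e|e|c1 IH1 c2 IH2|e c1 IH1 c2 IH2].
- by rewrite addn_gt0 magnitude_gt0.
- exact: magnitude_gt0.
- by rewrite muln_gt0 IH1.
- by rewrite addn_gt0 magnitude_gt0.
Qed.

Lemma eval_le M s e : 0 < M -> bounded M s -> eval s e <= magnitude e * M.
Proof.
move=> M0 sM; elim: e => [k|a _|e1 IH1 e2 IH2|e1 IH1 e2 IH2|e1 _ e2 _|e1 _ e2 _] /=.
- by nia.
- by have := sM (eval s a); nia.
- by lia.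
- by lia.
- by have := magnitude_gt0 e1; have := magnitude_gt0 e2; case: eqP => _ /=; nia.
- by have := magnitude_gt0 e1; have := magnitude_gt0 e2; case: leqP => _ /=; nia.
Qed.

Lemma fits_magnitude W M s e :
  0 < M -> bounded M s -> magnitude e * M < W -> fits W s e.
Proof.
move=> M0 sM.
elim: e => [k|a IH|e1 IH1 e2 IH2|e1 IH1 e2 IH2|e1 IH1 e2 IH2|e1 IH1 e2 IH2] lt_W;
  apply/andP; (split; first exact: leq_ltn_trans (eval_le _ M0 sM) lt_W) => //.
- by apply: IH; move: lt_W => /=; nia.
all: by apply/andP; split; [apply: IH1 | apply: IH2]; move: lt_W => /=; nia.
Qed.

Lemma update_bounded M s a v : bounded M s -> v <= M -> bounded M (update s a v).
Proof. by move=> sM vM i; rewrite /update; case: ifP. Qed.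

(** The bound [M] varies in the induction: in a sequence the second command starts from
    [growth c1 * M], which is why [growth] is multiplicative there. *)
Lemma exec_wp W M c s Q :
  0 < M -> bounded M s -> growth c * M < W -> wp c s Q ->
  exists t o s', [/\ exec W c s t o s', t <= max_time c,
                     bounded (growth c * M) s' & Q o s'].
Proof.
elim: c M s Q => [|a e|e|c1 IH1 c2 IH2|e c1 IH1 c2 IH2|//] M s Q M0 sM /=.
- move=> _ Qs; exists 1, [::], s; split=> //; first exact: exec_skip.
  by rewrite mul1n.
- move=> lt_W Qs; do 3 eexists; split; last exact: Qs; first 1 last.
  + exact: leqnn.
  + have := magnitude_gt0 a; have := magnitude_gt0 e => e0 a0.
    apply: update_bounded; last by have := eval_le e M0 sM; nia.
    by move=> i; have := sM i; nia.
  + by apply: exec_store; apply: (fits_magnitude M0 sM); nia.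
- move=> lt_W Qs; do 3 eexists; split; last exact: Qs; first 1 last.
  + exact: leqnn.
  + by move=> i; have := sM i; have := magnitude_gt0 e; nia.
  + by apply: exec_emit; apply: (fits_magnitude M0 sM); nia.
- move=> lt_W; have g1 := growth_gt0 c1; have g2 := growth_gt0 c2.
  case/(IH1 M s) => //; first by nia.
  move=> t1 [o1 [s1 [ex1 le1 s1M]]].
  case/(IH2 (growth c1 * M) s1) => //; [by nia | by nia |].
  move=> t2 [o2 [s2 [ex2 le2 s2M]]] Qs.
  exists (t1 + t2), (o1 ++ o2), s2; split=> //.
  + exact: exec_seq ex1 ex2.
  + exact: leq_add.
  + by move=> i; have := s2M i; nia.
- move=> lt_W; have g1 := growth_gt0 c1; have g2 := growth_gt0 c2.
  have fe : fits W s e by apply: (fits_magnitude M0 sM); nia.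
  have mono c' s' : growth c' <= growth c1 + growth c2 ->
      bounded (growth c' * M) s' ->
      bounded ((magnitude e + (growth c1 + growth c2)) * M) s'.
    by move=> le_g b i; have := b i; nia.
  case: eqP => /= [e0|/eqP e0].
  + case/(IH2 M s) => //; first by nia.
    move=> t [o [s' [ex le s'M]]] Qs; exists (cost e + t).+1, o, s'.
    split=> //; [exact: exec_if_false | by lia | apply: mono s'M; exact: leq_addl].
  + case/(IH1 M s) => //; first by nia.
    move=> t [o [s' [ex le s'M]]] Qs; exists (cost e + t).+1, o, s'.
    split=> //; [exact: exec_if_true | by lia | apply: mono s'M; exact: leq_addr].
Qed.

(** The same [M] is required before every call. From [growth] alone, the bound on the cells would
    grow geometrically with the number of calls. *)
Fixpoint yields (M : nat) (c : cmd) (s : memory) (S : seq nat) : Prop :=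
  bounded M s /\
  match S with
  | [::] => wp c s (fun o _ => o = [::])
  | r :: S' => wp c s (fun o s' => o = [:: r] /\ yields M c s' S')
  end.

Lemma yields_produces W b M c s S :
  0 < M -> growth c * M < W -> max_time c <= b -> yields M c s S ->
  produces W b c s S.
Proof.
move=> M0 lt_W le_b; elim: S s => [|r S IH] s [sM].
- case/(exec_wp M0 sM lt_W) => t [o [s' [ex le_t _ o0]]].
  by rewrite o0 in ex; apply: produces_end ex _; apply: leq_trans le_b.
- case/(exec_wp M0 sM lt_W) => t [o [s' [ex le_t _ [o1 ys]]]].
  rewrite o1 in ex; apply: produces_entry ex _ (IH _ ys).
  exact: leq_trans le_b.
Qed.

Definition time_bound (A : algorithm) : nat :=
  (max_time (init A) + max_time (next A) + growth (init A) + growth (next A)).+1.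

Lemma yields_loopless A n params S :
  0 < n -> bounded n (nth 0 params) ->
  wp (init A) (nth 0 params) (fun o s => o = [::] /\ yields n (next A) s S) ->
  generates_loopless A (time_bound A) n params S.
Proof.
move=> n0 pn ys; rewrite /generates_loopless.
(* Write [time_bound A] as [B.+1]. Then [g <= B < (n + 2) ^ B], and the remaining factor [n + 2]
   exceeds [n]. *)
have lt_W g : g < time_bound A -> g * n < (n + 2) ^ time_bound A.
  rewrite /time_bound expnS ltnS => le_g.
  have n1 : 1 < n + 2 by lia.
  move: le_g (ltn_expl (max_time (init A) + max_time (next A) + growth (init A)
                        + growth (next A)) n1) => le_g.
  by move: le_g; move: (_ + growth _) (_ ^ _) => B X; nia.
case/(exec_wp (W := (n + 2) ^ time_bound A) n0 pn): ys.
  by apply: lt_W; rewrite /time_bound; lia.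
move=> t [o [s [ex le_t _ [o0 ys]]]]; rewrite o0 in ex.
exists t, s; split=> //.
- by rewrite /time_bound; nia.
- apply: yields_produces ys => //; first by apply: lt_W; rewrite /time_bound; lia.
  by rewrite /time_bound; lia.
Qed.

(** * Entries of the sequences *)

(* [top r p] tells whether entry p of R_r is r. *)
Fixpoint top (r p : nat) : bool :=
  match r with
  | (_.+1 as r').+1 =>
      if p %% r == r' then ~~ top r' (p %/ r) else p %% r <= 1
  | _ => false
  end.

Arguments top : simpl never.

Lemma mkseq_block (T : Type) (f : nat -> T) k N :
  mkseq f (N * k) = flatten (mkseq (fun q => mkseq (fun j => f (q * k + j)) k) N).
Proof.
elim: N => [|N IH]; first by rewrite mul0n.
rewrite mulSnr [in RHS]/mkseq -[N.+1]addn1 iotaD map_cat flatten_cat /= cats0 -IH.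
by rewrite /mkseq iotaD map_cat add0n -[N * k in X in _ ++ X]addn0 iotaDl -map_comp.
Qed.

Lemma topSS r p :
  top r.+2 p = if p %% r.+2 == r.+1 then ~~ top r.+1 (p %/ r.+2) else p %% r.+2 <= 1.
Proof. by []. Qed.

Lemma topS r p j : 0 < r -> j < r.+1 ->
  top r.+1 (p * r.+1 + j) = if j == r then ~~ top r p else j <= 1.
Proof.
case: r => // r _ jr.
by rewrite topSS modnMDl modn_small // divnMDl // divn_small ?addn0.
Qed.

(** For k > 2 the entries r of R_(k-1) are k-1 or k-2. Both are recycled to blocks k, k, k-1, ...,
    k-1 of length k, except that the last entry is k when r = k-2. This is the recursion of
    [top]. *)
Lemma recycle_seqE k : 1 < k ->
  recycle_seq k = mkseq (fun p => k - ~~ top k p) k`!.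
Proof.
elim: k => // -[//|[|k]] IH _; first by [].
have -> : recycle_seq k.+3 = recycle k.+3 (recycle_seq k.+2) by [].
rewrite IH // (factS k.+2) [k.+3 * _]mulnC mkseq_block /recycle /mkseq -map_comp.
congr flatten; apply: eq_map => q; cbv beta delta [comp].
transitivity
  (mkseq (fun j => k.+3 - ~~ (if j == k.+2 then ~~ top k.+2 q else j <= 1)) k.+3);
  last by apply/eq_in_map => j; rewrite mem_iota => /andP[_ jk]; rewrite topS.
move: (top _ q) => b.
apply: (@eq_from_nth _ 0) => [|j].
  by rewrite size_mkseq !size_cat !size_nseq; case: b => /=; lia.
rewrite !size_cat !size_nseq => jk; rewrite nth_mkseq; last by case: b jk => /=; lia.
rewrite !nth_cat !nth_nseq !size_nseq.
by case: j jk => [|[|j]]; case: b => //= jk; repeat (case: ifP => ? //=); lia.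
Qed.

(** A block ends with k+2-r, where r is k or k-1, hence with 2 or 3. At that position [top k.+1]
    negates [top k], so it holds just when the entry is 3. *)
Lemma reuse_recycle_seqE k : 1 < k ->
  reuse k.+1 (recycle_seq k) =
  mkseq (fun p => if p %% k.+1 == k then 2 + top k.+1 p else k.+1) k.+1`!.
Proof.
move=> k1; rewrite recycle_seqE // (factS k) [k.+1 * _]mulnC mkseq_block.
rewrite /reuse /mkseq -map_comp.
congr flatten; apply: eq_map => q; cbv beta delta [comp].
have -> : iota 0 k.+1 = rcons (iota 0 k) k by rewrite -addn1 iotaD /= cats1.
rewrite map_rcons; congr rcons.
- apply: (@eq_from_nth _ 0); rewrite ?size_nseq ?size_map ?size_iota // => j jk.
  rewrite nth_nseq jk (nth_map 0) ?size_iota // nth_iota // add0n.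
  by rewrite modnMDl modn_small ?ltn_eqF //; lia.
- rewrite /= modnMDl modn_small // eqxx topS ?eqxx //; last lia.
  by case: top => /=; lia.
Qed.

(** * The focus-pointer counter *)

(* [counter C G r i p g]: the levels from i on, of radices r, r-1, ..., 1, hold the
   value p, modulo r!.  C gives the digits, except that a maximal digit is stored
   as 0.  G i is the offset from level i to the level in focus, that is, the length
   of the run of maximal digits starting at i; but it is stored as 0 when digit
   i-1 is maximal, so the true offset g of level i is a separate argument. *)
Fixpoint counter (C G : nat -> nat) (r i p g : nat) : Prop :=
  match r with
  | (_.+1 as r').+1 =>
      if p %% r == r' then
        [/\ C i = 0, G i.+1 = 0, 0 < g & counter C G r' i.+1 (p %/ r) g.-1]
      else [/\ C i = p %% r, g = 0 & counter C G r' i.+1 (p %/ r) (G i.+1)]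
  | _ => g = 0
  end.

Arguments counter : simpl never.

Lemma counterSS C G r i p g : counter C G r.+2 i p g =
  if p %% r.+2 == r.+1 then
        [/\ C i = 0, G i.+1 = 0, 0 < g & counter C G r.+1 i.+1 (p %/ r.+2) g.-1]
      else [/\ C i = p %% r.+2, g = 0 & counter C G r.+1 i.+1 (p %/ r.+2) (G i.+1)].
Proof. by []. Qed.

Lemma counter_ext C G C' G' r i p g :
  (forall j, i <= j -> C' j = C j) -> (forall j, i < j -> G' j = G j) ->
  counter C G r i p g -> counter C' G' r i p g.
Proof.
elim: r i p g => [//|[//|r] IH] i p g hC hG; rewrite !counterSS.
have IH' := IH i.+1 _ _ (fun j h => hC j (ltnW h)) (fun j h => hG j (ltnW h)).
rewrite hC // hG //.
by case: ifP => _ [h1 h2]; [move=> h3 /IH' | move/IH'].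
Qed.

Lemma counter0 r i : counter (fun=> 0) (fun=> 0) r i 0 0.
Proof. by elim: r i => [//|[//|r] IH] i; rewrite counterSS mod0n div0n. Qed.

(** Adding r! keeps the lowest digit and adds (r-1)! to the quotient; at radix 1 the value is no
    longer consulted. *)
Lemma counter_period C G r i p g :
  counter C G r i (r`! + p) g -> counter C G r i p g.
Proof.
elim: r i p g => [//|[//|r] IH] i p g; rewrite !counterSS.
rewrite factS mulnC modnMDl divnMDl //.
by case: ifP => _ [h1 h2]; [move=> h3 /IH | move/IH].
Qed.

(** Each of the [g] leading maximal digits negates once. The recursion then ends in the test of the
    focused digit, or at radix 1, where [top] is false. *)
Lemma counter_top C G r i p g : 0 < r ->
  counter C G r i p g -> top r p = odd g (+) ((g.+1 < r) && (C (i + g) <= 1)).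
Proof.
elim: r i p g => [//|[|r] IH] i p g _; first by rewrite /counter /top => ->.
rewrite counterSS topSS; case: ifP => _.
- case: g => [[]//|g] /= [_ _ _ /IH->] //.
  by rewrite addSnnS addNb ltnS.
- by move=> [Ci -> _]; rewrite addn0 Ci.
Qed.

Lemma counter_focus C G r i p g : 1 < r ->
  counter C G r i p g -> (g != 0) = (p %% r == r.-1).
Proof.
case: r => [|[|r]] // _; rewrite counterSS.
by case: ifP => [_ [_ _]|_ [_ -> _]] //; case: g.
Qed.

(** r! divides p+1 exactly when all digits are maximal, that is, when the focus is the level of
    radix 1. *)
Lemma counter_wrap C G r i p g : 0 < r ->
  counter C G r i p g -> g < r /\ (r <= g.+1) = (r`! %| p.+1).
Proof.
elim: r i p g => [//|[|r] IH] i p g _; first by rewrite /counter => ->; rewrite dvd1n.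
have -> : p.+1 = p %/ r.+2 * r.+2 + (p %% r.+2).+1.
  by rewrite {1}(divn_eq p r.+2) addnS.
rewrite counterSS factS; case: eqP => [->|].
- case: g => [[]//|g] [_ _ _ /IH[] // lt_g e]; split=> //.
  by rewrite -mulSnr [_ * r.+2]mulnC dvdn_pmul2l // ltnS -e.
- move=> ne [_ -> _]; split=> //; apply/esym/negP.
  move/(dvdn_trans (dvdn_mulr _ (dvdnn _))); rewrite dvdn_addr ?dvdn_mull //.
  by have := ltn_pmod p (isT : 0 < r.+2) => lt_p /dvdn_leq; lia.
Qed.

(** Level [j] has radix k-j, so its digit is about to become k-j-1, the maximum. The first conjunct
    excludes the level of radix 1, in focus only at the end of a cycle. *)
Definition exhausts k (C : nat -> nat) j := (j.+1 < k) && (k - j <= (C j).+2).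

Definition next_C k C j i :=
  if (i == j) && (j.+1 < k) then if exhausts k C j then 0 else (C j).+1 else C i.

(** A digit [j] that becomes maximal extends the run starting at [j.+1], whose own offset must then
    be stored as 0. *)
Definition next_G k C (G : nat -> nat) j i :=
  if exhausts k C j then
    if i == j then (G j.+1).+1 else if i == j.+1 then 0 else G i
  else G i.

(** [G i] has been cleared, its old value surviving as [g]. The carry turns the [g] maximal digits
    into 0, which is how they are stored already, and the offsets behind them are stored as 0 too.
    So no level before the focus has to be written. *)
Lemma counter_step C G k r i p g : 0 < r -> i + r = k -> G i = 0 ->
  counter C G r i p g ->
  counter (next_C k C (i + g)) (next_G k C G (i + g)) r i p.+1
          (next_G k C G (i + g) i).
Proof.
elim: r i p g => [//|[|r] IH] i p g _ ik Gi.
  rewrite /counter => ->; rewrite addn0 /next_G /exhausts.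
  by have -> : (i.+1 < k) = false by lia.
rewrite counterSS; case: eqP => maxp.
- case: g => [[]//|g] [Ci G1 _]; rewrite succnK => cnt.
  have := IH i.+1 _ _ isT _ G1 cnt; rewrite !addSnnS => /(_ ik) cnt'.
  rewrite counterSS.
  have -> : p.+1 = (p %/ r.+2).+1 * r.+2 by rewrite {1}(divn_eq p r.+2) maxp; lia.
  rewrite modnMl mulnK // -[0 == r.+1]/false; split => //.
  + by rewrite /next_C; have -> : (i == i + g.+1) = false by lia.
  + rewrite /next_G; case: ifP => // _.
    have -> : (i == i + g.+1) = false by lia.
    by have -> : (i == (i + g.+1).+1) = false by lia.
- move=> [Ci -> cnt]; rewrite addn0 counterSS.
  have lt_p := ltn_pmod p (isT : 0 < r.+2).
  have eq_p : p.+1 = p %/ r.+2 * r.+2 + (p %% r.+2).+1.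
    by rewrite {1}(divn_eq p r.+2) addnS.
  have lt_p1 : (p %% r.+2).+1 < r.+2 by move: (p %% _) maxp lt_p => x; lia.
  have eq_m : p.+1 %% r.+2 = (p %% r.+2).+1.
    by rewrite {1}eq_p modnMDl modn_small.
  have eq_q : p.+1 %/ r.+2 = p %/ r.+2.
    by rewrite eq_p divnMDl // (divn_small lt_p1) addn0.
  have i1k : i.+1 < k by lia.
  have nn : (i.+1 == i) = false by lia.
  have exE : exhausts k C i = ((p %% r.+2).+1 == r.+1).
    by rewrite /exhausts i1k Ci -ik; lia.
  rewrite eq_q eq_m -exE /next_C /next_G.
  case: ifP => ex; rewrite ex !eqxx i1k /= ?nn.
  + split=> //; apply: counter_ext cnt => j ij; first by rewrite gtn_eqF.
    by rewrite !gtn_eqF // ltnW.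
  + split=> //; first by rewrite Ci.
    by apply: counter_ext cnt => j ij //; rewrite gtn_eqF.
Qed.

(** * The programs *)

(* Registers 0 .. 8: the parameters n and m, the number k of levels, the focus
   j, its parity, the test on digit j, the end-of-cycle flag, and the phase and
   pass number of the rewind algorithm.  From cell 9 on, each level i has a
   digit, a focus offset and the parity of that offset.  Conjunctions and
   disjunctions of tests are encoded as comparisons of their sum with 2 and 1. *)
Notation reg_n := 0 (only parsing).
Notation reg_m := 1 (only parsing).
Notation reg_k := 2 (only parsing).
Notation reg_j := 3 (only parsing).
Notation reg_par := 4 (only parsing).
Notation reg_low := 5 (only parsing).
Notation reg_wrap := 6 (only parsing).
Notation reg_phase := 7 (only parsing).
Notation reg_pass := 8 (only parsing).

Definition digit_addr i := 9 + (i + (i + i)).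
Definition focus_addr i := 10 + (i + (i + i)).
Definition parity_addr i := 11 + (i + (i + i)).

Definition cell (base : nat) (e : expr) : expr :=
  Add (Const base) (Add e (Add e e)).

Notation digit e := (cell 9 e).
Notation focus e := (cell 10 e).
Notation parity e := (cell 11 e).

Definition register (c : nat) : expr := Get (Const c).
Definition succ (e : expr) : expr := Add e (Const 1).

Notation "c1 ;; c2" := (Seq c1 c2) (at level 80, right associativity).
Notation "a <~ e" := (Store a e) (at level 70).

(** Clearing the offset of level 0 provides the hypothesis [G i = 0] of [counter_step]. Parities are
    stored because expressions have no remainder operation. *)
Definition find_focus : cmd :=
  Const reg_j <~ Get (focus (Const 0)) ;;
  Const reg_par <~ Get (parity (Const 0)) ;;
  focus (Const 0) <~ Const 0 ;;
  parity (Const 0) <~ Const 0 ;;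
  Const reg_low <~ Leq (Const 2)
    (Add (Leq (Add (register reg_j) (Const 2)) (register reg_k))
         (Leq (Get (digit (register reg_j))) (Const 1))) ;;
  Const reg_wrap <~ Leq (register reg_k) (succ (register reg_j)).

Definition advance : cmd :=
  If (register reg_wrap) Skip
    (If (Leq (Sub (register reg_k) (register reg_j))
             (Add (Get (digit (register reg_j))) (Const 2)))
       (digit (register reg_j) <~ Const 0 ;;
        focus (register reg_j) <~ succ (Get (focus (succ (register reg_j)))) ;;
        parity (register reg_j) <~
          Sub (Const 1) (Get (parity (succ (register reg_j)))) ;;
        focus (succ (register reg_j)) <~ Const 0 ;;
        parity (succ (register reg_j)) <~ Const 0)
       (digit (register reg_j) <~ succ (Get (digit (register reg_j))))).

(** * Symbolic execution *)

Lemma updateE s a v b : update s a v b = if b == a then v else s b.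
Proof. by []. Qed.

Lemma wp_seqE c1 c2 s Q :
  wp (c1 ;; c2) s Q = wp c1 s (fun o1 s1 => wp c2 s1 (fun o2 => Q (o1 ++ o2))).
Proof. by []. Qed.

Lemma wp_ifE e c1 c2 s Q :
  wp (If e c1 c2) s Q = if eval s e != 0 then wp c1 s Q else wp c2 s Q.
Proof. by []. Qed.

(** The new memory is generalized and known only pointwise, which keeps terms small over many
    stores, and the bound [M] is preserved without growth. *)
Lemma wp_store M a e s (Q : seq nat -> memory -> Prop) :
  bounded M s -> eval s e <= M ->
  (forall s', bounded M s' -> s' =1 update s (eval s a) (eval s e) ->
     Q [::] s') ->
  wp (a <~ e) s Q.
Proof. by move=> sM eM h; apply: h => //; apply: update_bounded. Qed.

Lemma wp_store_seq M a e c s Q :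
  bounded M s -> eval s e <= M ->
  (forall s', bounded M s' -> s' =1 update s (eval s a) (eval s e) ->
     wp c s' Q) ->
  wp (a <~ e ;; c) s Q.
Proof. by move=> sM eM h; apply: h => //; apply: update_bounded. Qed.

Lemma eval_const s c : eval s (Const c) = c. Proof. by []. Qed.
Lemma eval_register s c : eval s (register c) = s c. Proof. by []. Qed.
Lemma eval_succ s e : eval s (succ e) = (eval s e).+1.
Proof. by rewrite /= addn1. Qed.
Lemma eval_digit s e : eval s (digit e) = digit_addr (eval s e).
Proof. by []. Qed.
Lemma eval_focus s e : eval s (focus e) = focus_addr (eval s e).
Proof. by []. Qed.
Lemma eval_parity s e : eval s (parity e) = parity_addr (eval s e).
Proof. by []. Qed.
Lemma eval_get s e : eval s (Get e) = s (eval s e). Proof. by []. Qed.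
Lemma eval_add s e1 e2 : eval s (Add e1 e2) = eval s e1 + eval s e2.
Proof. by []. Qed.
Lemma eval_sub s e1 e2 : eval s (Sub e1 e2) = eval s e1 - eval s e2.
Proof. by []. Qed.
Lemma eval_eq s e1 e2 : eval s (Eq e1 e2) = (eval s e1 == eval s e2).
Proof. by []. Qed.
Lemma eval_leq s e1 e2 : eval s (Leq e1 e2) = (eval s e1 <= eval s e2).
Proof. by []. Qed.

Definition evalE := (eval_digit, eval_focus, eval_parity, eval_register, eval_succ,
  eval_const, eval_get, eval_add, eval_sub, eval_eq, eval_leq).

Arguments wp : simpl never.
Arguments eval : simpl never.
Arguments cell : simpl never.
Arguments register : simpl never.
Arguments succ : simpl never.
Arguments digit_addr : simpl never.
Arguments focus_addr : simpl never.
Arguments parity_addr : simpl never.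

Lemma addr_eqE i j :
  ((digit_addr i == digit_addr j) = (i == j))
  * ((focus_addr i == focus_addr j) = (i == j))
  * ((parity_addr i == parity_addr j) = (i == j))
  * ((digit_addr i == focus_addr j) = false)
  * ((digit_addr i == parity_addr j) = false)
  * ((focus_addr i == digit_addr j) = false)
  * ((focus_addr i == parity_addr j) = false)
  * ((parity_addr i == digit_addr j) = false)
  * ((parity_addr i == focus_addr j) = false).
Proof. rewrite /digit_addr /focus_addr /parity_addr; do !split; lia. Qed.

Lemma register_eqE c i : c < 9 ->
  ((c == digit_addr i) = false)
  * ((c == focus_addr i) = false)
  * ((c == parity_addr i) = false)
  * ((digit_addr i == c) = false)
  * ((focus_addr i == c) = false)
  * ((parity_addr i == c) = false).
Proof. rewrite /digit_addr /focus_addr /parity_addr; do !split; lia. Qed.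

Tactic Notation "read" constr(E) := rewrite ?E ?updateE ?addr_eqE ?register_eqE //=.

(** * Correctness of a counter step *)

Lemma find_focus_wp n k s :
  bounded n s -> s reg_k = k -> 0 < k <= n ->
  let g := s (focus_addr 0) in
  wp find_focus s (fun o s' =>
    [/\ [/\ o = [::], bounded n s',
         s' reg_j = g, s' reg_par = s (parity_addr 0) &
         s' reg_low = (g.+1 < k) && (s (digit_addr g) <= 1)],
     s' reg_wrap = (k <= g.+1),
     forall i, s' (digit_addr i) = s (digit_addr i),
     forall i, s' (focus_addr i) = if i == 0 then 0 else s (focus_addr i) &
     forall i, s' (parity_addr i) = if i == 0 then 0 else s (parity_addr i)]
     /\ forall c, (c < 3) || (6 < c < 9) -> s' c = s c).
Proof.
move=> sn sk /andP[k0 kn] g.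
have n0 : 0 < n by apply: leq_trans kn.
rewrite /find_focus; apply: (wp_store_seq sn); rewrite !evalE // => s1 b1 E1.
apply: (wp_store_seq b1); rewrite !evalE; read E1 => s2 b2 E2.
apply: (wp_store_seq b2); rewrite !evalE // => s3 b3 E3.
apply: (wp_store_seq b3); rewrite !evalE // => s4 b4 E4.
apply: (wp_store_seq b4); rewrite !evalE; read E4; read E3; read E2; read E1.
  exact: leq_trans (leq_b1 _) n0.
rewrite sk -/g => s5 b5 E5.
apply: (wp_store b5); rewrite !evalE; read E5; read E4; read E3; read E2; read E1.
  exact: leq_trans (leq_b1 _) n0.
rewrite sk -/g => s6 b6 E6.
split; last first.
  move=> c; do 9![case: c => [|c]; first by move=> // _; rewrite E6 !updateE //= E5
    !updateE //= E4 !updateE ?register_eqE //= E3 !updateE ?register_eqE //=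
    E2 !updateE //= E1].
  by move=> h; exfalso; lia.
split; [split | | move=> i | move=> i | move=> i] => //.
all: read E6; read E5; read E4; read E3; read E2; read E1.
by rewrite addn2; case: (g.+1 < k); case: (s _ <= 1).
Qed.

Definition next_P k C (P : nat -> nat) j i :=
  if exhausts k C j then
    if i == j then 1 - P j.+1 else if i == j.+1 then 0 else P i
  else P i.

Lemma advance_wp n k j s :
  let C := fun i => s (digit_addr i) in
  let G := fun i => s (focus_addr i) in
  let P := fun i => s (parity_addr i) in
  bounded n s -> s reg_k = k -> 0 < k <= n -> s reg_j = j ->
  s reg_wrap = (k <= j.+1) -> G j.+1 < n ->
  wp advance s (fun o s' =>
    [/\ o = [::], bounded n s',
     forall i, s' (digit_addr i) = next_C k C j i,
     forall i, s' (focus_addr i) = next_G k C G j i &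
     forall i, s' (parity_addr i) = next_P k C P j i]
     /\ forall c, c < 9 -> s' c = s c).
Proof.
move=> C G P sn sk /andP[k0 kn] sj sw Gn.
have n0 : 0 < n by apply: leq_trans kn.
rewrite /advance wp_ifE !evalE sw /next_C /next_G /next_P /exhausts.
case: (leqP k j.+1) => [kj|jk] /=.
  by split=> //; split=> // i; rewrite andbF.
rewrite wp_ifE !evalE sk sj -/(C j) addn2.
case: leqP => [full|nfull] /=; last first.
  apply: (wp_store sn); rewrite !evalE sj -/(C j); first by lia.
  move=> s' s'n E; split; last by move=> c c9; read E.
  split=> // i; read E.
  by rewrite andbT.
apply: (wp_store_seq sn); rewrite !evalE ?sj // => s1 b1 E1.
apply: (wp_store_seq b1); rewrite !evalE; read E1; rewrite ?sj // => s2 b2 E2.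
apply: (wp_store_seq b2); rewrite !evalE; read E2; read E1; rewrite ?sj.
  by apply: leq_trans n0; rewrite leq_subr.
move=> s3 b3 E3.
apply: (wp_store_seq b3); rewrite !evalE; read E3; read E2; read E1.
rewrite ?sj => s4 b4 E4.
apply: (wp_store b4); rewrite !evalE; read E4; read E3; read E2; read E1.
rewrite ?sj => s5 b5 E5; split; last first.
  by move=> c c9; read E5; read E4; read E3; read E2; read E1.
split=> // i; read E5; read E4; read E3; read E2; read E1.
- by rewrite andbT.
- by case: (i =P j.+1) => // ->; rewrite gtn_eqF.
- by case: (i =P j.+1) => // ->; rewrite gtn_eqF.
Qed.

Definition step : cmd := find_focus ;; advance.

(** The last clause controls the word size: an offset incremented at level [j] is still at most k-j,
    hence at most [n]. *)
Definition counting n k p (s : memory) : Prop :=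
  [/\ bounded n s, s reg_k = k,
      counter (fun i => s (digit_addr i)) (fun i => s (focus_addr i))
              k 0 p (s (focus_addr 0)),
      forall i, s (parity_addr i) = odd (s (focus_addr i))
    & forall i, s (focus_addr i) <= k - i].

(** The flags describe the old position [p], although the counter has moved on. Equality of parity
    and digit test negates the exclusive or of [counter_top]. *)
Lemma step_wp n k p s : 1 < k <= n -> counting n k p s ->
  wp step s (fun o s' =>
    [/\ o = [::], counting n k p.+1 s',
        (s' reg_par == s' reg_low) = ~~ top k p,
        (s' reg_j != 0) = (p %% k == k.-1) & s' reg_wrap = (k`! %| p.+1)]
    /\ forall c, (c < 3) || (6 < c < 9) -> s' c = s c).
Proof.
case/andP=> k1 kn [sn sk cnt sP sG].
have k0 : 0 < k by apply: leq_trans k1.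
rewrite /step wp_seqE.
have k0n : 0 < k <= n by rewrite k0.
apply: wp_mono (find_focus_wp sn sk k0n) _ => o1 s1.
have [lt_g wrapE] := counter_wrap k0 cnt.
have topE := counter_top k0 cnt; have jE := counter_focus k1 cnt.
move: lt_g wrapE topE jE; set g := s (focus_addr 0) => lt_g wrapE topE jE.
case=> [[[-> s1n s1j s1par s1low] s1wrap s1C s1G s1P] s1s].
have s1k : s1 reg_k = k by rewrite s1s.
have G1n : s1 (focus_addr g.+1) < n.
  by rewrite s1G /=; have := sG g.+1; lia.
apply: wp_mono (advance_wp s1n s1k k0n s1j s1wrap G1n) _ => o2 s2.
case=> [[-> s2n s2C s2G s2P] s2s1]; split; last first.
  by move=> c c3; rewrite s2s1 ?s1s //; lia.
split=> //; last first.
- by rewrite s2s1 // s1wrap wrapE.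
- by rewrite s2s1 // s1j.
- rewrite !s2s1 // s1par s1low sP topE add0n.
  by case: odd; case: (_ && _).
split=> //; first by rewrite s2s1.
- have G10 : s1 (focus_addr 0) = 0 by rewrite s1G.
  have cnt1 : counter (fun i => s1 (digit_addr i)) (fun i => s1 (focus_addr i)) k 0 p g.
    apply: counter_ext cnt => j j0 //; rewrite s1G.
    by case: j j0.
  have := counter_step k0 (add0n k) G10 cnt1; rewrite add0n -s2G.
  by apply: counter_ext => j _.
- move=> i; rewrite s2P s2G /next_P /next_G.
  have s1odd j : s1 (parity_addr j) = odd (s1 (focus_addr j)).
    by rewrite s1P s1G sP; case: ifP.
  case: ifP => // _; case: ifP => _; last by case: ifP.
  by rewrite s1odd /=; case: odd.
- move=> i; rewrite s2G /next_G.
  have s1G_le j : s1 (focus_addr j) <= k - j.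
    by rewrite s1G; case: ifP.
  case: ifP => // _; case: eqP => [->|_]; last by case: ifP.
  by have := s1G_le g.+1; lia.
Qed.

(** * Emitters and the single-cycle generator *)

Definition emits (c : cmd) (f : nat -> nat -> nat) : Prop :=
  forall k p s, 1 < k -> s reg_k = k ->
    (s reg_par == s reg_low) = ~~ top k p ->
    (s reg_j != 0) = (p %% k == k.-1) ->
    wp c s (fun o s' => o = [:: f k p] /\ s' = s).

Definition emit_recycle : cmd :=
  Emit (Sub (register reg_k) (Eq (register reg_par) (register reg_low))).

Definition emit_reuse : cmd :=
  If (register reg_j)
     (Emit (Sub (Const 3) (Eq (register reg_par) (register reg_low))))
     (Emit (register reg_k)).

Definition recycle_entry k p := k - ~~ top k p.
Definition reuse_entry k p := if p %% k == k.-1 then 2 + top k p else k.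

Lemma emits_recycle : emits emit_recycle recycle_entry.
Proof.
move=> k p s _ sk par _.
by rewrite /emit_recycle /wp evalE !evalE par sk.
Qed.

Lemma emits_reuse : emits emit_reuse reuse_entry.
Proof.
move=> k p s _ sk par j; rewrite /emit_reuse wp_ifE evalE j /reuse_entry.
by case: (_ == k.-1) => /=; rewrite /wp !evalE ?par ?sk //; case: top.
Qed.

Definition next_once (c : cmd) : cmd :=
  If (register reg_wrap) Skip (step ;; c).

Lemma next_once_yields n k p s c f :
  emits c f -> 1 < k <= n -> p <= k`! -> counting n k p s ->
  s reg_wrap = (p == k`!) ->
  yields n (next_once c) s [seq f k q | q <- iota p (k`! - p)].
Proof.
move=> cf kn; move dN: (k`! - p) => N.
elim: N p s dN => [|N IH] p s dN pk scnt sw.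
  split; first by case: scnt.
  by rewrite /next_once wp_ifE !evalE sw (_ : p == k`!) //; lia.
split; first by case: scnt.
rewrite /next_once wp_ifE evalE sw; have -> /= : (p == k`!) = false by lia.
rewrite wp_seqE; apply: wp_mono (step_wp kn scnt) _ => o s1.
case=> [[-> s1cnt par j wrap] _].
have [_ s1k _ _ _] := s1cnt; have /andP[k1 _] := kn.
apply: wp_mono (cf k p s1 k1 s1k par j) _ => _ _ [-> ->]; split=> //.
(* As 0 < p+1 <= k!, divisibility by k! means equality with k!. *)
apply: IH => //; [lia|lia|rewrite wrap; congr nat_of_bool].
by apply/idP/eqP => [/dvdn_leq|->//]; lia.
Qed.

(** * The rewind generator *)

(** Passes 0 and m-1 are followed by n-1, n and lead to phase 1; the others are followed by n alone
    and lead to phase 2. *)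
Definition end_pass : cmd :=
  Const reg_phase <~ Sub (Const 2)
    (Leq (Const 1) (Add (Eq (register reg_pass) (Const 0))
                        (Eq (succ (register reg_pass)) (register reg_m)))) ;;
  Const reg_pass <~ succ (register reg_pass).

(* Phase 0 emits T, phase 1 the entry n-1, phase 2 the entry n that ends a pass
   over T, and phase 3 the final copies of n, which it counts down to 2 in the
   pass register.  A pass starts at entry 2 of the base sequence, whence the two
   silent steps. *)
Definition next_rewind (c : cmd) : cmd :=
  If (Eq (register reg_phase) (Const 0))
    (step ;; c ;; If (register reg_wrap) (end_pass ;; step ;; step) Skip)
    (If (Eq (register reg_phase) (Const 1))
      (Emit (register reg_k) ;; Const reg_phase <~ Const 2)
      (If (Eq (register reg_phase) (Const 2))
        (Emit (register reg_n) ;;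
         Const reg_phase <~
           (Add (Leq (register reg_m) (register reg_pass))
             (Add (Leq (register reg_m) (register reg_pass))
                  (Leq (register reg_m) (register reg_pass)))))
        (If (Leq (Const 3) (register reg_pass))
          (Emit (register reg_n) ;;
           Const reg_pass <~ Sub (register reg_pass) (Const 1))
          Skip))).

Lemma counting_ext n k p s s' : counting n k p s -> bounded n s' ->
  (forall c, (c == reg_k) || (8 < c) -> s' c = s c) -> counting n k p s'.
Proof.
case=> sn sk cnt sP sG s'n s's.
have sD i : s' (digit_addr i) = s (digit_addr i) by apply: s's.
have sF i : s' (focus_addr i) = s (focus_addr i) by apply: s's.
have sQ i : s' (parity_addr i) = s (parity_addr i) by apply: s's.
split=> // [|||i]; rewrite ?s's // ?sF //.
- by apply: counter_ext cnt.
- by move=> i; rewrite sQ sF.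
Qed.

Lemma counting_restart n k s : counting n k k`! s -> counting n k 0 s.
Proof.
case=> sn sk cnt sP sG; split=> //; apply: counter_period.
by rewrite addn0.
Qed.

Lemma counting0 n k s : bounded n s -> s reg_k = k ->
  (forall c, 8 < c -> s c = 0) -> counting n k 0 s.
Proof.
move=> sn sk s0.
have sD i : s (digit_addr i) = 0 by apply: s0.
have sF i : s (focus_addr i) = 0 by apply: s0.
have sQ i : s (parity_addr i) = 0 by apply: s0.
split=> // [|i|i]; rewrite ?sF ?sQ //.
by apply: counter_ext (counter0 k 0).
Qed.

Definition ready n m k p ph q s :=
  counting n k p s /\ [/\ s reg_n = n, s reg_m = m, s reg_phase = ph & s reg_pass = q].

Lemma ready_step n m k p ph q s : 1 < k <= n -> ready n m k p ph q s ->
  wp step s (fun o s' =>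
    [/\ o = [::], ready n m k p.+1 ph q s',
        (s' reg_par == s' reg_low) = ~~ top k p,
        (s' reg_j != 0) = (p %% k == k.-1) & s' reg_wrap = (k`! %| p.+1)]).
Proof.
move=> kn [scnt [s0 s1 s7 s8]].
apply: wp_mono (step_wp kn scnt) _ => o s' [[-> s'cnt par j wrap] s's].
by split=> //; split=> //; rewrite !s's.
Qed.

Lemma ready_step2 n m k ph q s : 1 < k <= n -> ready n m k 0 ph q s ->
  wp (step ;; step) s (fun o s' => o = [::] /\ ready n m k 2 ph q s').
Proof.
move=> kn rs; rewrite wp_seqE.
apply: wp_mono (ready_step kn rs) _ => o1 s1 [-> rs1 _ _ _].
by apply: wp_mono (ready_step kn rs1) _ => o2 s2 [-> rs2 _ _ _].
Qed.

Section Rewind.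
Variables (n m k : nat) (c : cmd) (f : nat -> nat -> nat).
Hypotheses (n3 : 2 < n) (kn : 1 < k <= n) (m_ge2 : 1 < m) (mn : m <= n).
Hypothesis cf : emits c f.

Let yield := yields n (next_rewind c).
Let last_phase q := 2 - ((q == 0) || (q.+1 == m)).

Lemma end_pass_wp q s : ready n m k k`! 0 q s -> q < m ->
  wp (end_pass ;; step ;; step) s
    (fun o s' => o = [::] /\ ready n m k 2 (last_phase q) q.+1 s').
Proof.
move=> [scnt [s0 s1 s7 s8]] qm; have [sn _ _ _ _] := scnt.
have le2 : last_phase q <= n by rewrite /last_phase; lia.
have lphE : 2 - (0 < (q == 0) + (q.+1 == m)) = last_phase q.
  by rewrite /last_phase; do 2 case: eqP.
rewrite /end_pass wp_seqE.
apply: (wp_store_seq sn); rewrite !evalE s8 s1 lphE // => t1 b1 E1.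
apply: (wp_store b1); rewrite !evalE; read E1; rewrite s8; first by lia.
move=> t2 b2 E2; apply: ready_step2 => //; split.
  apply: counting_restart; apply: counting_ext scnt b2 _ => a a_gt.
  have [a7 a8] : (a == 7) = false /\ (a == 8) = false by lia.
  by rewrite E2 updateE a8 E1 updateE a7.
by split; read E2; read E1.
Qed.

(** The call that emits the last entry of a pass also restarts the counter, since a silent call
    would signal the end of the sequence. *)
Lemma pass_yields p q s S : ready n m k p 0 q s -> p < k`! -> q < m ->
  (forall s', ready n m k 2 (last_phase q) q.+1 s' -> yield s' S) ->
  yield s ([seq f k x | x <- iota p (k`! - p)] ++ S).
Proof.
have /andP[k1 _] := kn.
move=> + + qm yS; move dN: (k`! - p) => N; elim: N p s dN => [|N IH] p s dN rs pk.
  by lia.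
have [scnt [_ _ s7 _]] := rs; split; first by case: scnt.
rewrite /next_rewind wp_ifE !evalE s7 /= wp_seqE.
apply: wp_mono (ready_step kn rs) _ => o1 s1 [-> rs1 par j wrap].
have [[_ s1k _ _ _] _] := rs1.
rewrite wp_seqE; apply: wp_mono (cf k1 s1k par j) _ => _ _ [-> ->].
rewrite wp_ifE !evalE wrap; case: N IH dN => [|N] IH dN.
- have eq_p : p.+1 = k`! by lia.
  rewrite eq_p dvdnn /=; rewrite eq_p in rs1.
  by apply: wp_mono (end_pass_wp rs1 qm) _ => o2 s2 [-> rs2]; split=> //; exact: yS.
- rewrite (_ : (_ %| _) = false) /=; last by apply/negP => /dvdn_leq; lia.
  by rewrite /wp; split=> //; apply: IH => //; lia.
Qed.

Lemma ready_store ph q ph' q' s s' : ready n m k 2 ph q s -> bounded n s' ->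
  s' reg_phase = ph' -> s' reg_pass = q' ->
  (forall a, (a != reg_phase) && (a != reg_pass) -> s' a = s a) ->
  ready n m k 2 ph' q' s'.
Proof.
move=> [scnt [s0 s1 s7 s8]] b' s'7 s'8 s's; split; last by split; rewrite ?s'7 ?s'8 ?s's.
by apply: counting_ext scnt b' _ => a ha; apply: s's; lia.
Qed.

Lemma yields_k q s S : ready n m k 2 1 q s ->
  (forall s', ready n m k 2 2 q s' -> yield s' S) -> yield s (k :: S).
Proof.
move=> rs yS; have [[sn sk _ _ _] [s0 s1 s7 s8]] := rs; split=> //.
rewrite /next_rewind wp_ifE !evalE s7 /= wp_ifE !evalE s7 /= wp_seqE {1}/wp !evalE sk.
apply: (wp_store sn); rewrite !evalE; first by lia.
move=> s' b' E; split=> //; apply: yS; apply: ready_store rs b' _ _ _; read E => //.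
by move=> a /andP[/negbTE a7 _]; rewrite E updateE a7.
Qed.

(** Here [q] counts completed passes. The test [m <= q], added three times, gives phase 3 after the
    last pass and phase 0 before. *)
Lemma yields_n q s S : ready n m k 2 2 q s ->
  (forall s', ready n m k 2 (if m <= q then 3 else 0) q s' -> yield s' S) ->
  yield s (n :: S).
Proof.
move=> rs yS; have [[sn sk _ _ _] [s0 s1 s7 s8]] := rs; split=> //.
rewrite /next_rewind wp_ifE !evalE s7 /= wp_ifE !evalE s7 /= wp_ifE !evalE s7 /=.
rewrite wp_seqE {1}/wp !evalE s0.
apply: (wp_store sn); rewrite !evalE s1 s8; first by case: (m <= q); lia.
move=> s' b' E; split=> //; apply: yS; apply: ready_store rs b' _ _ _; read E => //.
  by case: (m <= q).
by move=> a /andP[/negbTE a7 _]; rewrite E updateE a7.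
Qed.

(** The pass register enters this phase with value m while m-2 copies remain, whence the offset
    2. *)
Lemma yields_tail r s : ready n m k 2 3 r.+2 s -> yield s (nseq r n).
Proof.
elim: r s => [|r IH] s rs; have [[sn sk _ _ _] [s0 s1 s7 s8]] := rs; split=> //.
all: rewrite /next_rewind wp_ifE !evalE s7 /= wp_ifE !evalE s7 /= wp_ifE !evalE s7 /=.
all: rewrite wp_ifE !evalE s8 //=.
rewrite wp_seqE {1}/wp !evalE s0.
apply: (wp_store sn); rewrite !evalE s8; first by have := sn 8; rewrite s8; lia.
move=> s' b' E; split=> //; apply: IH; apply: ready_store rs b' _ _ _; read E => //.
by move=> a /andP[_ /negbTE a8]; rewrite E updateE a8.
Qed.

Let T := [seq f k x | x <- iota 2 (k`! - 2)].

Lemma rewind_yields s : 2 < k`! -> ready n m k 2 0 0 s ->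
  yield s ((T ++ [:: k; n]) ++ flatten (nseq (m - 2) (T ++ [:: n])) ++
           (T ++ [:: k; n]) ++ nseq (m - 2) n).
Proof.
move=> k3 rs; rewrite -!catA; apply: (pass_yields rs) => //; first by lia.
move=> {rs}s; rewrite /last_phase /= => rs.
apply: (yields_k rs) => {rs}s rs; apply: (yields_n rs) => {rs}s.
rewrite leqNgt m_ge2 /= => rs.
(* With [q] passes done, [i] middle passes and the last one remain. *)
suff mid i q s' : 0 < q -> q + i.+1 = m -> ready n m k 2 0 q s' ->
    yield s' (flatten (nseq i (T ++ [:: n])) ++ T ++ [:: k; n] ++ nseq (m - 2) n).
  by apply: (mid _ 1) => //; lia.
elim: i q s' {rs} => [|i IH] q s' q0 qm rs.
- apply: (pass_yields rs) => //; first by lia.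
  move=> {rs}s'; rewrite /last_phase (_ : q.+1 == m) ?orbT => [rs|]; last by lia.
  apply: (yields_k rs) => {rs}s' rs; apply: (yields_n rs) => {rs}s'.
  rewrite (_ : m <= q.+1) => [rs|]; last by lia.
  by apply: yields_tail; rewrite (_ : (m - 2).+2 = q.+1) //; lia.
- rewrite [flatten _]/= -!catA; apply: (pass_yields rs) => //; first by lia.
  move=> {rs}s'; rewrite /last_phase.
  rewrite (_ : (q == 0) || (q.+1 == m) = false) => [rs|]; last by lia.
  apply: (yields_n rs) => {rs}s'; rewrite (_ : (m <= q.+1) = false) => [rs|]; last by lia.
  by apply: IH rs; lia.
Qed.
End Rewind.

(** * Initialization and the three families *)

Definition init_rewind : cmd :=
  Const reg_k <~ Sub (register reg_n) (Const 1) ;; step ;; step.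

Lemma rewind_loopless c f n m : emits c f -> 4 <= n -> 2 <= m <= n ->
  generates_loopless (Algorithm init_rewind (next_rewind c))
    (time_bound (Algorithm init_rewind (next_rewind c))) n [:: n; m]
    (rewind n m (rot 2 (mkseq (f n.-1) n.-1`!))).
Proof.
move=> cf n4 /andP[m2 mn].
have k3 : 2 < n.-1`! by apply: leq_trans (fact_geq _); lia.
have sn : bounded n (nth 0 [:: n; m]).
  by case=> [|[|a]] //=; rewrite nth_nil.
have kn : 1 < n.-1 <= n by lia.
apply: yields_loopless => //; first by lia.
apply: (wp_store_seq sn); rewrite !evalE /=; first by lia.
move=> s b E.
have rs : ready n m n.-1 0 0 0 s.
  split; last by rewrite !E.
  apply: counting0 => //; first by rewrite E /= subn1.
  move=> a a8; rewrite E updateE; case: eqP a8 => [->//|_].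
  by case: a => [|[|a]] //= _; rewrite nth_nil.
apply: wp_mono (ready_step2 kn rs) _ => o s' [-> rs']; split=> //.
(* The rotation moves entries 0 and 1 to the end, where [rewind] cuts them off, so T consists of the
   entries from 2 on. *)
have -> : rewind n m (rot 2 (mkseq (f n.-1) n.-1`!)) =
  let T := [seq f n.-1 x | x <- iota 2 (n.-1`! - 2)] in
  (T ++ [:: n.-1; n]) ++ flatten (nseq (m - 2) (T ++ [:: n])) ++
           (T ++ [:: n.-1; n]) ++ nseq (m - 2) n.
  rewrite /rewind size_rot size_mkseq /rot /mkseq.
  have -> : drop 2 [seq f n.-1 i | i <- iota 0 n.-1`!]
            = [seq f n.-1 i | i <- iota 2 (n.-1`! - 2)].
    by rewrite -map_drop drop_iota.
  by rewrite take_size_cat // size_map size_iota.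
by apply: rewind_yields => //; lia.
Qed.

Theorem theorem11 :
  (exists (A : algorithm) (b : nat), forall n : nat, 3 <= n ->
     generates_loopless A b n [:: n] (reuse n (recycle_seq n.-1)))
  /\ (exists (A : algorithm) (b : nat), forall n m : nat, 4 <= n -> 2 <= m <= n ->
     generates_loopless A b n [:: n; m] (rewind n m (rot 2 (recycle_seq n.-1))))
  /\ (exists (A : algorithm) (b : nat), forall n m : nat, 4 <= n -> 2 <= m <= n ->
     generates_loopless A b n [:: n; m]
       (rewind n m (rot 2 (reuse n.-1 (recycle_seq n.-2))))).
Proof.
split; last split.
- pose A := Algorithm (Const reg_k <~ register reg_n) (next_once emit_reuse).
  exists A, (time_bound A) => n n3.
  have sn : bounded n (nth 0 [:: n]) by case=> [|a] //=; rewrite nth_nil.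
  apply: yields_loopless => //; first by lia.
  apply: (wp_store sn); rewrite !evalE //= => s b E; split=> //.
  case: n n3 sn b E => // k k2 _ b E.
  rewrite reuse_recycle_seqE // /mkseq -[X in iota 0 X]subn0.
  apply: (next_once_yields emits_reuse) => //; first by rewrite ltnS ltnW /=.
  + apply: counting0 => //.
    move=> a a8; rewrite E updateE; case: eqP a8 => [->//|_].
    by case: a => [|a] //= _; rewrite nth_nil.
  + by rewrite E /= eq_sym; have := fact_gt0 k.+1; case: (_`!).
- pose A := Algorithm init_rewind (next_rewind emit_recycle).
  exists A, (time_bound A) => n m n4 mn; rewrite recycle_seqE; last by lia.
  exact: (rewind_loopless emits_recycle).
- pose A := Algorithm init_rewind (next_rewind emit_reuse).
  exists A, (time_bound A) => n m n4 mn; case: n n4 mn => [|[|n]] // n4 mn.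
  rewrite reuse_recycle_seqE //.
  exact: (rewind_loopless emits_reuse).
Qed.
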